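(* The satisfiability problem and the validity problem for $\mathcal{L}_0$-formulas over static network models are decidable: there are algorithms which, given $\varphi\in\mathcal{L}_0$, decide whether there are a static network model $M$ and an agent $a$ of $M$ with $M,a\models\varphi$, and whether $M,a\models\varphi$ for every static network model $M$ and every agent $a$ of $M$.
   Context: Fix a positive integer $m$ and $G=\{0,\frac1m,\frac2m,\ldots,1\}$; for $r,s\in G$ let $r\oplus s=\min\{1,r+s\}$. Let $A$ be a finite nonempty set of agents, $P$ a nonempty (possibly infinite) set of propositional atoms, and $\Omega$ a finite set of nominals with $P\cap\Omega=\varnothing$ and $|\Omega|=|A|$. Static network model: a tuple $M=(A,(\sim_r)_{r\in G},V)$ where $V:P\cup\Omega\to\wp(A)$ is such that each $V(i)$, $i\in\Omega$, is a singleton and the map sending $i$ to the unique member of $V(i)$ is a bijection $\Omega\to A$; and each $\sim_r\subseteq A\times A$, with, for all $a,b,c\in A$, $r,s\in G$: $a\sim_r a$; $a\sim_r b\Leftrightarrow b\sim_r a$; $a\sim_1 b$; $a\sim_r b\Rightarrow a\sim_s b$ if $r\le s$; $a\sim_r b$ and $b\sim_s c$ imply $a\sim_{r\oplus s}c$. Language $\mathcal{L}_0$: $\varphi::=p\mid i\mid\neg\varphi\mid(\varphi\land\psi)\mid\langle r\rangle\varphi\mid @_i\varphi$ with $p\in P$, $i\in\Omega$, $r\in G$. Semantics at $a\in A$: $M,a\models p$ iff $a\in V(p)$; $M,a\models i$ iff $a\in V(i)$; Boolean clauses as usual; $M,a\models\langle r\rangle\varphi$ iff $M,b\models\varphi$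 for some $b\in A$ with $a\sim_r b$; $M,a\models @_i\varphi$ iff $M,b\models\varphi$ where $V(i)=\{b\}$. *)

(* Defs.v *)
From mathcomp Require Import all_boot all_order all_algebra.

Set Implicit Arguments.
Unset Strict Implicit.
Unset Printing Implicit Defensive.

Import Order.TTheory GRing.Theory Num.Theory.

(* Total recursive functions, in the classical presentation by minimization
   of regular functions: [f] is regular when every [x] admits a zero [y] of
   [f (y, x)], and [h x] is the least one. *)
Inductive recursive : forall n : nat, (n.-tuple nat -> nat) -> Prop :=
| recursive_zero n : recursive (fun _ : n.-tuple nat => 0)
| recursive_succ : recursive (fun x : 1.-tuple nat => (thead x).+1)
| recursive_proj n (i : 'I_n) : recursive (fun x : n.-tuple nat => tnth x i)
| recursive_comp k n (f : k.-tuple nat -> nat)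
    (g : 'I_k -> n.-tuple nat -> nat) :
    recursive f -> (forall i, recursive (g i)) ->
    recursive (fun x : n.-tuple nat => f [tuple g i x | i < k])
| recursive_prec n (f : n.-tuple nat -> nat) (g : n.+2.-tuple nat -> nat) :
    recursive f -> recursive g ->
    recursive (fun x : n.+1.-tuple nat =>
      nat_rect (fun=> nat) (f [tuple of behead x])
        (fun y z => g [tuple of y :: z :: behead x]) (thead x))
| recursive_mu n (f : n.+1.-tuple nat -> nat) (h : n.-tuple nat -> nat) :
    recursive f ->
    (forall x, f [tuple of h x :: x] = 0) ->
    (forall x y, y < h x -> f [tuple of y :: x] <> 0) ->
    recursive h.

(* The element k/m of G is represented by the ordinal k <= m. *)
Notation grade m := 'I_m.+1.

Definition grade_val (m : nat) (r : grade m) : rat := (r%:R / m%:R)%R.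

Definition oplus (m : nat) (r s : grade m) : grade m := inord (minn m (r + s)).

Lemma grade_val_le (m : nat) (r s : grade m) :
  0 < m -> (grade_val r <= grade_val s)%R = (r <= s).
Proof.
by move=> m0; rewrite /grade_val ler_pM2r ?ler_nat // invr_gt0 ltr0n.
Qed.

Lemma grade_val_oplus (m : nat) (r s : grade m) : 0 < m ->
  grade_val (oplus r s) = Num.min 1%R (grade_val r + grade_val s)%R.
Proof.
move=> m0; have m0' : (0 < m%:R :> rat)%R by rewrite ltr0n.
rewrite /grade_val /oplus inordK ?ltnS ?geq_minl // -mulrDl -natrD.
rewrite -[X in Num.min X _](mulfV (lt0r_neq0 m0')) /minn /Order.min.
by rewrite ltr_pM2r ?invr_gt0 // ltr_nat; case: ifP.
Qed.

(* [inl] injects the atoms and [inr] the nominals, so that the two are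
   disjoint. *)
Record static_model (m : nat) (A : finType) (P : Type) (Omega : finType) :=
  StaticModel {
    sim : grade m -> rel A;
    val : P + Omega -> {set A};
    val_nominal : exists2 f : Omega -> A,
      forall i, val (inr i) = [set f i] & bijective f;
    sim_refl : forall r a, sim r a a;
    sim_sym : forall r a b, sim r a b <-> sim r b a;
    sim_top : forall a b, sim ord_max a b;
    sim_mono : forall (r s : grade m) a b, r <= s -> sim r a b -> sim s a b;
    sim_trans : forall (r s : grade m) a b c,
      sim r a b -> sim s b c -> sim (oplus r s) a c }.

Inductive formula (m : nat) (P : Type) (Omega : finType) : Type :=
| Atom of P
| Nominal of Omega
| Neg of formula m P Omega
| Conj of formula m P Omega & formula m P Omega
| Dia of grade m & formula m P Omega
| At of Omega & formula m P Omega.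

Fixpoint satisfies (m : nat) (A : finType) (P : Type) (Omega : finType)
    (M : static_model m A P Omega) (a : A) (phi : formula m P Omega) : Prop :=
  match phi with
  | Atom p => a \in val M (inl p)
  | Nominal i => a \in val M (inr i)
  | Neg psi => ~ satisfies M a psi
  | Conj psi chi => satisfies M a psi /\ satisfies M a chi
  | Dia r psi => exists b, sim M r a b /\ satisfies M b psi
  | At i psi => exists b, val M (inr i) = [set b] /\ satisfies M b psi
  end.

Definition satisfiable (m : nat) (A : finType) (P : Type) (Omega : finType)
    (phi : formula m P Omega) : Prop :=
  exists (M : static_model m A P Omega) (a : A), satisfies M a phi.

Definition valid (m : nat) (A : finType) (P : Type) (Omega : finType)
    (phi : formula m P Omega) : Prop :=
  forall (M : static_model m A P Omega) (a : A), satisfies M a phi.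

Fixpoint occurs (m : nat) (P : Type) (Omega : finType) (p : P)
    (phi : formula m P Omega) : Prop :=
  match phi with
  | Atom q => p = q
  | Nominal _ => False
  | Neg psi => occurs p psi
  | Conj psi chi => occurs p psi \/ occurs p chi
  | Dia _ psi => occurs p psi
  | At _ psi => occurs p psi
  end.

(* Gödel numbering of formulas, given numerical names for the atoms. *)
Fixpoint code (m : nat) (P : Type) (Omega : finType) (name : P -> nat)
    (phi : formula m P Omega) : nat :=
  match phi with
  | Atom p => CodeSeq.code [:: 0; name p]
  | Nominal i => CodeSeq.code [:: 1; enum_rank i : nat]
  | Neg psi => CodeSeq.code [:: 2; code name psi]
  | Conj psi chi => CodeSeq.code [:: 3; code name psi; code name chi]
  | Dia r psi => CodeSeq.code [:: 4; r : nat; code name psi]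
  | At i psi => CodeSeq.code [:: 5; enum_rank i : nat; code name psi]
  end.

Lemma code_inj (m : nat) (P : Type) (Omega : finType) (name : P -> nat) :
  injective name -> injective (@code m P Omega name).
Proof.
move=> name_inj; have rk (i j : Omega) : enum_rank i = enum_rank j :> nat -> i = j.
  by move=> e; apply/enum_rank_inj/val_inj.
elim=> [p|i|f IHf|f IHf g IHg|r f IHf|i f IHf]
  [q|j|f'|f' g'|s f'|j f'] e; have := can_inj CodeSeq.codeK e => // -[].
- by move=> /name_inj ->.
- by move=> /rk ->.
- by move=> /IHf ->.
- by move=> /IHf -> /IHg ->.
- by move=> /val_inj -> /IHf ->.
- by move=> /rk -> /IHf ->.
Qed.

(* [Q] is decided by a recursive function that receives formulas through their
   Gödel numbers. As [P] need not be countable, there may be no injective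
   numbering of all the atoms; but only finitely many of them occur in the
   input [phi], and one and the same function is required to be correct for
   every naming of the atoms that distinguishes those occurring in [phi]. When
   [P] is countable this applies to any fixed injective numbering of [P]. *)
Definition algorithmically_decidable (m : nat) (P : Type) (Omega : finType)
    (Q : formula m P Omega -> Prop) : Prop :=
  exists chi : 1.-tuple nat -> nat, recursive chi /\
    forall (name : P -> nat) (phi : formula m P Omega),
      (forall p q, occurs p phi -> occurs q phi -> name p = name q -> p = q) ->
      (Q phi -> chi [tuple code name phi] = 1) /\
      (~ Q phi -> chi [tuple code name phi] = 0).

(* Main.v *)
(* Since [A] and [Omega] are finite, so is the set of all pairs of a frame (the
   relations together with the naming of agents) and an agent. On their disjoint
   union, a formula denotes one of finitely many sets, computed by recursion on
   the formula from the sets denoted by its atoms; it is satisfiable exactly when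
   some assignment of sets to its atoms gives it a set that contains a point of a
   genuine network frame. An assignment is coded by the digits of a number [v] in
   the base given by the number of sets. As names of atoms of [phi] are smaller
   than the code [n] of [phi], it is enough to try [v < base ^ n]. A formula is
   valid when its negation is not satisfiable. *)
Require Import Defs.
From mathcomp Require Import all_boot all_order all_algebra.
From mathcomp Require Import boolp.

Set Implicit Arguments.
Unset Strict Implicit.
Unset Printing Implicit Defensive.

(** * Recursive functions *)

(** [recursive] is an inductive predicate on functions, so closure under pointwise equality is
    obtained from functional extensionality. *)
Lemma eq_recursive n (f g : n.-tuple nat -> nat) :
  f =1 g -> recursive f -> recursive g.
Proof. by move=> /funext ->. Qed.

(** Plain numerals can thus index arguments: beyond the arity, [nth] falls back on the constant
    0. *)
Lemma recursive_nth n i : recursive (fun x : n.-tuple nat => nth 0 x i).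
Proof.
case: (ltnP i n) => [lt_in|le_ni].
  apply: eq_recursive (recursive_proj (Ordinal lt_in)) => x.
  by rewrite (tnth_nth 0).
by apply: eq_recursive (recursive_zero n) => x; rewrite nth_default ?size_tuple.
Qed.

Lemma recursive_comp1 n (h : nat -> nat) (f : n.-tuple nat -> nat) :
  recursive (fun x : 1.-tuple nat => h (nth 0 x 0)) -> recursive f ->
  recursive (fun x => h (f x)).
Proof.
move=> rec_h rec_f.
apply: eq_recursive (recursive_comp (g := fun=> f) rec_h (fun=> rec_f)) => x.
by rewrite -(tnth_nth 0 _ ord0) tnth_mktuple.
Qed.

Lemma recursive_comp2 n (h : nat -> nat -> nat) (f g : n.-tuple nat -> nat) :
  recursive (fun x : 2.-tuple nat => h (nth 0 x 0) (nth 0 x 1)) ->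
  recursive f -> recursive g -> recursive (fun x => h (f x) (g x)).
Proof.
move=> rec_h rec_f rec_g; pose F (i : 'I_2) := if i == 0 :> nat then f else g.
have rec_F i : recursive (F i) by rewrite /F; case: ifP.
apply: eq_recursive (recursive_comp rec_h rec_F) => x.
rewrite -(tnth_nth 0 _ ord0) -(tnth_nth 0 _ (Ordinal (ltnSn 1))).
by rewrite !tnth_mktuple.
Qed.

Lemma recursive_nat_rect (f : nat -> nat) (g : nat -> nat -> nat -> nat) :
  recursive (fun x : 1.-tuple nat => f (nth 0 x 0)) ->
  recursive (fun x : 3.-tuple nat => g (nth 0 x 0) (nth 0 x 1) (nth 0 x 2)) ->
  recursive (fun x : 2.-tuple nat =>
    nat_rect (fun=> nat) (f (nth 0 x 1)) (fun y z => g y z (nth 0 x 1))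
      (nth 0 x 0)).
Proof.
move=> rec_f rec_g; apply: eq_recursive (recursive_prec rec_f rec_g) => x.
by case/tupleP: x => y x; case/tupleP: x => z x; rewrite theadE.
Qed.

(** Minimization for tests: read as a number, [P] vanishes where it fails, and [h a b] is the first
    such place. *)
Lemma recursive_least n (P : nat -> nat -> nat -> bool) (h : nat -> nat -> nat)
    (f g : n.-tuple nat -> nat) :
  recursive (fun x : 3.-tuple nat =>
    P (nth 0 x 0) (nth 0 x 1) (nth 0 x 2) : nat) ->
  (forall a b, ~~ P (h a b) a b) ->
  (forall a b y, y < h a b -> P y a b) ->
  recursive f -> recursive g -> recursive (fun x => h (f x) (g x)).
Proof.
move=> rec_P P_h P_lt_h; apply: recursive_comp2; apply: (recursive_mu rec_P).
  by move=> x /=; rewrite (negbTE (P_h _ _)).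
by move=> x y /P_lt_h /= ->.
Qed.

(** * Arithmetic, tests and bounded sums *)

Lemma recursive_S n (f : n.-tuple nat -> nat) :
  recursive f -> recursive (fun x => (f x).+1).
Proof.
apply: recursive_comp1; apply: eq_recursive recursive_succ => x.
by rewrite /thead (tnth_nth 0).
Qed.

Lemma recursive_const n c : recursive (fun _ : n.-tuple nat => c).
Proof. by elim: c => [|c /recursive_S //]; exact: recursive_zero. Qed.

Lemma recursive_add n (f g : n.-tuple nat -> nat) :
  recursive f -> recursive g -> recursive (fun x => f x + g x).
Proof.
apply: recursive_comp2.
have := @recursive_nat_rect (fun a => a) (fun _ z _ => z.+1) (recursive_nth _ _)
  (recursive_S (recursive_nth _ _)).
by apply: eq_recursive => x; elim: (nth 0 x 0) => //= n' ->.
Qed.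

Lemma recursive_mul n (f g : n.-tuple nat -> nat) :
  recursive f -> recursive g -> recursive (fun x => f x * g x).
Proof.
apply: recursive_comp2.
have := @recursive_nat_rect (fun=> 0) (fun _ z a => a + z) (recursive_const _ _)
  (recursive_add (recursive_nth _ _) (recursive_nth _ _)).
by apply: eq_recursive => x; elim: (nth 0 x 0) => //= n' ->; rewrite mulSn.
Qed.

Lemma recursive_pred n (f : n.-tuple nat -> nat) :
  recursive f -> recursive (fun x => (f x).-1).
Proof.
move=> rec_f; apply: (@recursive_comp2 _ (fun a _ => a.-1)) rec_f (rec_f).
have := @recursive_nat_rect (fun=> 0) (fun y _ _ => y) (recursive_const _ _)
  (recursive_nth _ _).
by apply: eq_recursive => x; case: (nth 0 x 0).
Qed.

Lemma recursive_sub n (f g : n.-tuple nat -> nat) :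
  recursive f -> recursive g -> recursive (fun x => f x - g x).
Proof.
(* Primitive recursion runs on the first argument, hence the swap: the subtrahend counts the
   predecessors taken. *)
move=> rec_f rec_g; apply: (@recursive_comp2 _ (fun a b => b - a)) rec_g rec_f.
have := @recursive_nat_rect (fun a => a) (fun _ z _ => z.-1) (recursive_nth _ _)
  (recursive_pred (recursive_nth _ _)).
apply: eq_recursive => x; elim: (nth 0 x 0) => [|k /= ->].
  by rewrite subn0.
by rewrite subnS.
Qed.

Lemma recursive_exp n (f g : n.-tuple nat -> nat) :
  recursive f -> recursive g -> recursive (fun x => f x ^ g x).
Proof.
move=> rec_f rec_g; apply: (@recursive_comp2 _ (fun a b => b ^ a)) rec_g rec_f.
have := @recursive_nat_rect (fun=> 1) (fun _ z a => a * z) (recursive_const _ _)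
  (recursive_mul (recursive_nth _ _) (recursive_nth _ _)).
by apply: eq_recursive => x; elim: (nth 0 x 0) => [|k /= ->] //=; rewrite expnS.
Qed.

Lemma recursive_leq n (f g : n.-tuple nat -> nat) :
  recursive f -> recursive g -> recursive (fun x => (f x <= g x : nat)).
Proof.
move=> rec_f rec_g.
have := recursive_sub (recursive_const n 1) (recursive_sub rec_f rec_g).
by apply: eq_recursive => x; rewrite /leq; case: (f x - g x).
Qed.

Lemma recursive_eq n (f g : n.-tuple nat -> nat) :
  recursive f -> recursive g -> recursive (fun x => (f x == g x : nat)).
Proof.
move=> rec_f rec_g.
have := recursive_mul (recursive_leq rec_f rec_g) (recursive_leq rec_g rec_f).
by apply: eq_recursive => x; rewrite eqn_leq mulnb.
Qed.

Lemma recursive_if n (b : n.-tuple nat -> bool) (f g : n.-tuple nat -> nat) :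
  recursive (fun x => b x : nat) -> recursive f -> recursive g ->
  recursive (fun x => if b x then f x else g x).
Proof.
move=> rec_b rec_f rec_g.
have := recursive_add (recursive_mul rec_b rec_f)
  (recursive_mul (recursive_sub (recursive_const n 1) rec_b) rec_g).
by apply: eq_recursive => x; case: (b x); rewrite ?mul1n ?mul0n ?addn0.
Qed.

Lemma recursive_and n (b c : n.-tuple nat -> bool) :
  recursive (fun x => b x : nat) -> recursive (fun x => c x : nat) ->
  recursive (fun x => b x && c x : nat).
Proof.
move=> rec_b rec_c; have := recursive_mul rec_b rec_c.
by apply: eq_recursive => x; rewrite mulnb.
Qed.

Lemma recursive_sum n (I : Type) (r : seq I) (F : I -> n.-tuple nat -> nat) :
  (forall i, recursive (F i)) -> recursive (fun x => \sum_(i <- r) F i x).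
Proof.
move=> rec_F; elim: r => [|i r IHr].
  by apply: eq_recursive (recursive_zero n) => x; rewrite big_nil.
by apply: eq_recursive (recursive_add (rec_F i) IHr) => x; rewrite big_cons.
Qed.

Lemma recursive_bounded_sum n (h : nat -> nat -> nat)
    (f g : n.-tuple nat -> nat) :
  recursive (fun x : 2.-tuple nat => h (nth 0 x 0) (nth 0 x 1)) ->
  recursive f -> recursive g ->
  recursive (fun x => \sum_(y < f x) h y (g x)).
Proof.
move=> rec_h; apply: (@recursive_comp2 _ (fun a b => \sum_(y < a) h y b)).
have := @recursive_nat_rect (fun=> 0) (fun y z b => z + h y b)
  (recursive_const _ _) (recursive_add (recursive_nth _ _)
    (recursive_comp2 rec_h (recursive_nth _ _) (recursive_nth _ _))).
apply: eq_recursive => x; elim: (nth 0 x 0) => [|k /= ->].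
  by rewrite big_ord0.
by rewrite big_ord_recr.
Qed.

Lemma recursive_div n (f g : n.-tuple nat -> nat) :
  recursive f -> recursive g -> recursive (fun x => f x %/ g x).
Proof.
(* The quotient is the least [y] with [a < y.+1 * b]; the guard [0 < b] stops the search at 0 when
   dividing by 0. *)
apply: (@recursive_least _ (fun y a b => (0 < b) && (y.+1 * b <= a)) divn).
- apply: recursive_and; apply: recursive_leq.
  + exact: recursive_const.
  + exact: recursive_nth.
  + by apply: recursive_mul; [apply: recursive_S|]; exact: recursive_nth.
  + exact: recursive_nth.
- by move=> a b; case: b => //= b; rewrite -ltnNge ltn_ceil.
- move=> a [|b] y; first by rewrite divn0.
  by move=> lt_y; rewrite /= -leq_divRL.
Qed.

Lemma recursive_mod n (f g : n.-tuple nat -> nat) :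
  recursive f -> recursive g -> recursive (fun x => f x %% g x).
Proof.
move=> rec_f rec_g.
have := recursive_sub rec_f (recursive_mul (recursive_div rec_f rec_g) rec_g).
by apply: eq_recursive => x; rewrite {1}(divn_eq (f x) (g x)) addKn.
Qed.

(** * Codes of sequences *)

Definition code_head n := head 0 (CodeSeq.decode n).
Definition code_behead n := CodeSeq.code (behead (CodeSeq.decode n)).

Lemma code_head_code s : code_head (CodeSeq.code s) = head 0 s.
Proof. by rewrite /code_head CodeSeq.codeK. Qed.

Lemma code_behead_code s :
  code_behead (CodeSeq.code s) = CodeSeq.code (behead s).
Proof. by rewrite /code_behead CodeSeq.codeK. Qed.

(** The code of [k :: s] is [2 ^ k] times an odd number, so the head is the exponent of 2 in the
    code. The guard [0 < a] handles the empty sequence, whose code is 0. *)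
Lemma recursive_code_head n (f : n.-tuple nat -> nat) :
  recursive f -> recursive (fun x => code_head (f x)).
Proof.
move=> rec_f.
apply: (@recursive_least _ (fun y a _ => (0 < a) && (a %% 2 ^ y.+1 == 0))
  (fun a _ => code_head a)) rec_f (rec_f).
- apply: recursive_and.
    by apply: recursive_leq; [exact: recursive_const | exact: recursive_nth].
  apply: recursive_eq; last exact: recursive_const.
  apply: recursive_mod; first exact: recursive_nth.
  apply: recursive_exp; first exact: recursive_const.
  exact/recursive_S/recursive_nth.
- move=> a _; rewrite -(CodeSeq.decodeK a) code_head_code.
  case: CodeSeq.decode => //= k s; rewrite negb_and -/(dvdn _ _) expnSr.
  by rewrite dvdn_pmul2l ?expn_gt0 // dvdn2 /= odd_double orbT.
- move=> a _ y; rewrite -(CodeSeq.decodeK a) code_head_code.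
  case: CodeSeq.decode => //= k s lt_yk; rewrite muln_gt0 expn_gt0 /=.
  by rewrite -/(dvdn _ _) dvdn_mulr // dvdn_exp2l.
Qed.

(** Removing the power of 2 leaves [2 * c + 1], where [c] codes the tail; halving recovers [c]. *)
Lemma recursive_code_behead n (f : n.-tuple nat -> nat) :
  recursive f -> recursive (fun x => code_behead (f x)).
Proof.
move=> rec_f; have := recursive_div (recursive_div rec_f
  (recursive_exp (recursive_const n 2) (recursive_code_head rec_f)))
  (recursive_const n 2).
apply: eq_recursive => x; rewrite -(CodeSeq.decodeK (f x)).
rewrite code_head_code code_behead_code; case: CodeSeq.decode => //= k s.
by rewrite mulKn ?expn_gt0 // divn2 /= uphalf_double.
Qed.

Lemma recursive_code_cons n (f : n.-tuple nat -> nat)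
    (s : n.-tuple nat -> seq nat) :
  recursive f -> recursive (fun x => CodeSeq.code (s x)) ->
  recursive (fun x => CodeSeq.code (f x :: s x)).
Proof.
move=> rec_f rec_s; apply: recursive_mul.
  by apply: recursive_exp; [exact: recursive_const | exact: rec_f].
have := recursive_S (recursive_add rec_s rec_s).
by apply: eq_recursive => x; rewrite addnn.
Qed.

(** * Digits in a base and finite case distinctions *)

Definition digit (B t i : nat) := t %/ B ^ i %% B.

(** Induction on [n] that splits off the lowest digit and shifts the others down by one. *)
Lemma digit_sum B (e : nat -> nat) n j : (forall i, e i < B) -> j < n ->
  digit B (\sum_(i < n) e i * B ^ i) j = e j.
Proof.
move=> lt_eB; have B_gt0 : 0 < B by exact: leq_ltn_trans (lt_eB 0).
elim: n j e lt_eB => // n IHn j e lt_eB lt_jn.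
rewrite big_ord_recl expn0 muln1.
under eq_bigr do rewrite expnSr mulnA.
rewrite -big_distrl /= addnC /digit; case: j lt_jn => [|j] lt_jn.
  by rewrite divn1 modnMDl modn_small.
rewrite expnS divnMA divnMDl // (divn_small (lt_eB 0)) addn0.
exact: (IHn j (fun i => e i.+1)).
Qed.

Lemma sum_digits_lt B (e : nat -> nat) n : (forall i, e i < B) ->
  \sum_(i < n) e i * B ^ i < B ^ n.
Proof.
move=> lt_eB; elim: n => [|n IHn]; first by rewrite big_ord0.
rewrite big_ord_recr /= expnS.
by rewrite (leq_trans _ (leq_mul (lt_eB n) (leqnn _))) // mulSn ltn_add2r.
Qed.

Lemma recursive_digit n B (f g : n.-tuple nat -> nat) :
  recursive f -> recursive g -> recursive (fun x => digit B (f x) (g x)).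
Proof.
move=> rec_f rec_g; apply: recursive_mod; last exact: recursive_const.
apply: recursive_div => //; apply: recursive_exp => //.
exact: recursive_const.
Qed.

Lemma sum_select (T : finType) (e F : T -> nat) t : injective e ->
  \sum_(u : T) ((e t == e u) * F u) = F t.
Proof.
move=> inj_e; rewrite (bigD1 t) //= eqxx mul1n big1 ?addn0 // => u neq_ut.
by rewrite (inj_eq inj_e) eq_sym (negbTE neq_ut).
Qed.

(** A case distinction over a finite type is a finite sum of products. When the branches are
    constants, any function on [T] becomes recursive in this way, however its values are defined. *)
Lemma recursive_select n (T : finType) (e : T -> nat) (f : n.-tuple nat -> nat)
    (F : T -> n.-tuple nat -> nat) :
  recursive f -> (forall t, recursive (F t)) ->
  recursive (fun x => \sum_(t : T) ((f x == e t) * F t x)).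
Proof.
move=> rec_f rec_F; apply: recursive_sum => t; apply: recursive_mul => //.
by apply: recursive_eq => //; exact: recursive_const.
Qed.
(** * Evaluation of formulas over all frames at once *)

Section Extensions.

Variables (m : nat) (A : finType) (P : Type) (Omega : finType).

(** No law is imposed on the relations or on the naming, so this is a plain finite type;
    [model_worlds] singles out the frames of genuine models. *)
Definition frame : finType :=
  ({ffun grade m * A * A -> bool} * {ffun Omega -> A})%type.

Definition extent : finType := {set frame * A}.

Definition extent_nominal (i : Omega) : extent :=
  [set w : frame * A | w.2 == w.1.2 i].

Definition extent_dia (r : grade m) (X : extent) : extent :=
  [set w : frame * A | [exists b, w.1.1 (r, w.2, b) && ((w.1, b) \in X)]].

Definition extent_at (i : Omega) (X : extent) : extent :=
  [set w : frame * A | (w.1, w.1.2 i) \in X].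

Fixpoint extension (V : P -> extent) (phi : formula m P Omega) : extent :=
  match phi with
  | Atom p => V p
  | Nominal i => extent_nominal i
  | Neg psi => ~: extension V psi
  | Conj psi chi => extension V psi :&: extension V chi
  | Dia r psi => extent_dia r (extension V psi)
  | At i psi => extent_at i (extension V psi)
  end.

Definition carries (F : frame) (M : static_model m A P Omega) : Prop :=
  (forall r a b, sim M r a b = F.1 (r, a, b)) /\
  (forall i, Defs.val M (inr i) = [set F.2 i]).

(** All operations on extents stay inside one frame, so the part of an extension lying over [F] is
    the truth set in any model carried by [F]. *)
Lemma satisfies_extension (F : frame) (M : static_model m A P Omega)
    (V : P -> extent) :
  carries F M -> (forall p a, (a \in Defs.val M (inl p)) = ((F, a) \in V p)) ->
  forall phi a, satisfies M a phi <-> (F, a) \in extension V phi.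
Proof.
move=> [simF nomF] atomF; elim=> [p|i|f IHf|f IHf g IHg|r f IHf|i f IHf] a /=.
- by rewrite atomF.
- by rewrite nomF !inE.
- by rewrite inE; split=> [n_f|/negP n_f /IHf//]; apply/negP => /IHf.
- rewrite inE; split=> [[/IHf -> /IHg ->]//|/andP[fa ga]].
  by split; [exact/IHf | exact/IHg].
- rewrite inE; split=> [[b [ab /IHf fb]]|/existsP[b /andP[ab fb]]].
    by apply/existsP; exists b; rewrite -simF ab.
  by exists b; split; [rewrite simF | exact/IHf].
- rewrite inE; split=> [[b [+ /IHf fb]]|fb].
    by rewrite nomF => /set1_inj ->.
  by exists (F.2 i); split=> //; exact/IHf.
Qed.

Lemma carries_exists (M : static_model m A P Omega) : exists F, carries F M.
Proof.
have [f nomf _] := val_nominal M.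
exists ([ffun t => sim M t.1.1 t.1.2 t.2], [ffun i => f i]).
by split=> [r a b|i]; rewrite ffunE.
Qed.

(** The laws of a model constrain only its relations and its nominals, so the atoms can be revalued
    freely. *)
Lemma carries_valuation (F : frame) (M : static_model m A P Omega)
    (U : P -> {set A}) :
  carries F M ->
  exists2 N : static_model m A P Omega,
    carries F N & forall p, Defs.val N (inl p) = U p.
Proof.
case: M => sm vl vl_nom s_refl s_sym s_top s_mono s_trans [/= simF nomF].
pose vl' x := if x is inl p then U p else vl x.
by exists (@StaticModel m A P Omega sm vl' vl_nom s_refl s_sym s_top s_mono
  s_trans).
Qed.

(** The classical test is harmless for computability: this is one fixed finite set, and it enters
    the algorithm only through constants. *)
Definition model_worlds : extent :=
  [set w : frame * A |
    `[< exists M : static_model m A P Omega, carries w.1 M >]].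

Lemma satisfiable_extension (phi : formula m P Omega) :
  satisfiable A phi <->
  exists V : P -> extent, extension V phi :&: model_worlds != set0.
Proof.
split=> [[M [a satM]]|[V /set0Pn[[F a]]]].
  have [F FM] := carries_exists M.
  (* The same valuation is copied onto every frame; only the copy over [F] matters. *)
  pose V p : extent := [set w : frame * A | w.2 \in Defs.val M (inl p)].
  exists V; apply/set0Pn; exists (F, a); rewrite !inE; apply/andP; split.
    by apply/(satisfies_extension FM) => // p b; rewrite inE.
  by apply/asboolP; exists M.
rewrite !inE => /andP[Fa /asboolP[M /= FM]].
have [N FN valN] := carries_valuation (fun p => [set a | (F, a) \in V p]) FM.
exists N, a; apply/(satisfies_extension FN (V := V)) => // p b.
by rewrite valN inE.
Qed.

(** * Evaluation by arithmetic and bounded search *)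

Definition base : nat := #|extent|.

Lemma base_gt0 : 0 < base.
Proof. by apply/card_gt0P; exists set0. Qed.

(* [t] is the tag of a formula code and [k], [l] its arguments; [vk] is the value
   of the atom named [k], and [ek], [el] are the values at [k] and [l] read as
   formula codes. The sums are definitions by cases: one term is nonzero. *)
Definition truth_case (t k l vk ek el : nat) : nat :=
  if t == 0 then vk
  else if t == 1 then
    \sum_(i : Omega) ((k == enum_rank i) * enum_rank (extent_nominal i))
  else if t == 2 then
    \sum_(X : extent) ((ek == enum_rank X) * enum_rank (~: X : extent))
  else if t == 3 then
    \sum_(X : extent) ((ek == enum_rank X) *
      \sum_(Y : extent) ((el == enum_rank Y) * enum_rank (X :&: Y : extent)))
  else if t == 4 then
    \sum_(r : grade m) ((k == r) *
      \sum_(X : extent) ((el == enum_rank X) * enum_rank (extent_dia r X)))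
  else
    \sum_(i : Omega) ((k == enum_rank i) *
      \sum_(X : extent) ((el == enum_rank X) * enum_rank (extent_at i X))).

(** [z] is the table of values at numbers below [y]. Reducing modulo [base] makes every value a
    legitimate digit at once, whether or not [y] codes a formula. *)
Definition truth_step (v y z : nat) : nat :=
  let k := code_head (code_behead y) in
  let l := code_head (code_behead (code_behead y)) in
  truth_case (code_head y) k l
    (digit base v k) (digit base z k) (digit base z l) %% base.

(* Course-of-values recursion: the digits of the table are the values at all
   [y < n], just as those of [v] are the values of the atoms. *)
Definition truth_table (v n : nat) : nat :=
  nat_rect (fun=> nat) 0 (fun y z => z + truth_step v y z * base ^ y) n.

Definition truth_value (v y : nat) : nat := truth_step v y (truth_table v y).

Lemma truth_value_lt v y : truth_value v y < base.
Proof. by rewrite ltn_mod base_gt0. Qed.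

Lemma digit_truth_table v n y : y < n ->
  digit base (truth_table v n) y = truth_value v y.
Proof.
move=> lt_yn.
have -> : truth_table v n = \sum_(i < n) truth_value v i * base ^ i.
  elim: n {lt_yn} => [|n IHn]; first by rewrite big_ord0.
  by rewrite big_ord_recr -IHn.
by rewrite digit_sum // => i; exact: truth_value_lt.
Qed.

(** The entries of a sequence are smaller than its code, so the table already contains their values.
    A missing entry is read as 0, which is also below the code. *)
Lemma truth_value_cons v t s :
  let k := nth 0 s 0 in let l := nth 0 s 1 in
  truth_value v (CodeSeq.code (t :: s)) =
  truth_case t k l (digit base v k) (truth_value v k) (truth_value v l) %% base.
Proof.
have lt_nth i : nth 0 s i < CodeSeq.code (t :: s).
  case: (ltnP i (size s)) => [lt_is|le_si].
    by apply: (allP (CodeSeq.ltn_code _)); rewrite inE mem_nth ?orbT.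
  rewrite nth_default //.
  exact: leq_trans (allP (CodeSeq.ltn_code _) t (mem_head _ _)).
rewrite /truth_value {1}/truth_step !(code_head_code, code_behead_code).
have -> : head 0 (behead (t :: s)) = nth 0 s 0 by rewrite -nth0.
have -> : head 0 (behead (behead (t :: s))) = nth 0 s 1.
  by rewrite -nth0 nth_behead.
by rewrite !digit_truth_table.
Qed.

Lemma truth_value_code (V : P -> extent) (name : P -> nat) (v : nat)
    (phi : formula m P Omega) :
  (forall p, occurs p phi -> digit base v (name p) = enum_rank (V p)) ->
  truth_value v (code name phi) = enum_rank (extension V phi).
Proof.
have rank_inj (T : finType) : injective (fun t : T => enum_rank t : nat).
  by move=> t u /val_inj/enum_rank_inj.
have rank_mod (X : extent) : enum_rank X %% base = enum_rank X.
  by rewrite modn_small.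
pose sum_rank (T : finType) F t := sum_select F t (rank_inj T).
elim: phi => [p|i|f IHf|f IHf g IHg|r f IHf|i f IHf] valV.
- by rewrite (truth_value_cons v 0 [:: name p]) /truth_case /= valV.
- rewrite (truth_value_cons v 1 [:: enum_rank i : nat]) /truth_case.
  by rewrite ![nth _ _ _]/= sum_rank rank_mod.
- rewrite (truth_value_cons v 2 [:: code name f]) /truth_case.
  by rewrite ![nth _ _ _]/= IHf // sum_rank rank_mod.
- rewrite (truth_value_cons v 3 [:: code name f; code name g]) /truth_case.
  rewrite ![nth _ _ _]/= IHf => [|p occ]; last by apply: valV; left.
  rewrite IHg => [|p occ]; last by apply: valV; right.
  by rewrite !sum_rank rank_mod.
- rewrite (truth_value_cons v 4 [:: r : nat; code name f]) /truth_case.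
  rewrite ![nth _ _ _]/= IHf // (sum_select _ _ val_inj).
  by rewrite sum_rank rank_mod.
- rewrite (truth_value_cons v 5 [:: enum_rank i : nat; code name f]).
  by rewrite /truth_case ![nth _ _ _]/= IHf // !sum_rank rank_mod.
Qed.

(** This is 1 or 0 according to whether the set denoted under [v] meets [model_worlds]; the sum over
    all extents turns that test into a table of constants. *)
Definition truth_sat (v n : nat) : nat :=
  \sum_(X : extent)
    ((truth_value v n == enum_rank X) * (X :&: model_worlds != set0)).

Definition sat_count (n : nat) : nat := \sum_(v < base ^ n) truth_sat v n.

(** This bounds the search: the digits at positions below the code determine the values of all atoms
    of [phi]. *)
Lemma occurs_ltn_code (name : P -> nat) (phi : formula m P Omega) p :
  occurs p phi -> name p < code name phi.
Proof.
have mem_lt s k : k \in s -> k < CodeSeq.code s := allP (CodeSeq.ltn_code s) k.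
elim: phi => [q|i|f IHf|f IHf g IHg|r f IHf|i f IHf] //=.
- by move=> ->; apply: (mem_lt [:: 0; name q]); rewrite !inE eqxx orbT.
- move=> /IHf/ltn_trans; apply.
  by apply: (mem_lt [:: 2; code name f]); rewrite !inE eqxx orbT.
- move=> [/IHf|/IHg] /ltn_trans; apply;
    apply: (mem_lt [:: 3; code name f; code name g]);
    by rewrite !inE eqxx ?orbT.
- move=> /IHf/ltn_trans; apply.
  by apply: (mem_lt [:: 4; r : nat; code name f]); rewrite !inE eqxx !orbT.
- move=> /IHf/ltn_trans; apply.
  apply: (mem_lt [:: 5; enum_rank i : nat; code name f]).
  by rewrite !inE eqxx !orbT.
Qed.

Lemma satisfiable_sat_count (name : P -> nat) (phi : formula m P Omega) :
  (forall p q, occurs p phi -> occurs q phi -> name p = name q -> p = q) ->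
  satisfiable A phi <-> 0 < sat_count (code name phi).
Proof.
move=> name_inj; rewrite lt0n sum_nat_eq0.
apply: iff_trans (satisfiable_extension _) _.
have rank_inj : injective (fun X : extent => enum_rank X : nat).
  by move=> X Y /val_inj/enum_rank_inj.
split=> [[V satV]|].
  (* [g] moves the assignment from atoms to names. It is well defined since [name] separates the
     atoms of [phi]; names of no such atom get the empty set. *)
  have /choice[g gP] x : exists X : extent,
      forall p, occurs p phi -> name p = x -> V p = X.
    have [[p [occ_p <-]]|no_p] := EM (exists p, occurs p phi /\ name p = x).
      by exists (V p) => q occ_q /name_inj ->.
    by exists set0 => p occ_p px; case: no_p; exists p.
  have g_lt x : enum_rank (g x) < base by [].
  (* The witness has the ranks of the sets [g i] as its digits. *)
  apply/forallPn; exists (Ordinal (sum_digits_lt (code name phi) g_lt)) => /=.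
  rewrite /truth_sat (@truth_value_code V) => [|p occ_p].
    by rewrite (sum_select _ _ rank_inj) satV.
  by rewrite (digit_sum g_lt) ?occurs_ltn_code // (gP (name p) p).
move=> /forallPn[v]; rewrite negb_imply /= sum_nat_eq0 => /forallPn[X].
rewrite negb_imply /= muln_eq0 !eqb0 negb_or !negbK => /andP[/eqP vX satX].
(* Conversely, each digit of [v] is the rank of an extent, which gives an assignment. *)
have digit_lt p : digit base v (name p) < base by rewrite ltn_mod base_gt0.
exists (fun p => enum_val (Ordinal (digit_lt p))).
suff -> : extension (fun p => enum_val (Ordinal (digit_lt p))) phi = X by [].
apply: rank_inj; rewrite -vX; apply/esym/truth_value_code => p _.
by rewrite enum_valK.
Qed.

(** * Recursiveness of the evaluation and of the search *)

Lemma recursive_truth_case n (t k l vk ek el : n.-tuple nat -> nat) :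
  recursive t -> recursive k -> recursive l ->
  recursive vk -> recursive ek -> recursive el ->
  recursive (fun x => truth_case (t x) (k x) (l x) (vk x) (ek x) (el x)).
Proof.
move=> rec_t rec_k rec_l rec_vk rec_ek rec_el.
have rec_tag c : recursive (fun x => t x == c : nat).
  by apply: recursive_eq => //; exact: recursive_const.
rewrite /truth_case; do ?[apply: recursive_if => //];
  do 2?[apply: recursive_select => // ?]; exact: recursive_const.
Qed.

Lemma recursive_truth_step n (f g h : n.-tuple nat -> nat) :
  recursive f -> recursive g -> recursive h ->
  recursive (fun x => truth_step (f x) (g x) (h x)).
Proof.
move=> rec_f rec_g rec_h; apply: recursive_mod; last exact: recursive_const.
have rec_tl := recursive_code_behead rec_g.
have rec_k := recursive_code_head rec_tl.
have rec_l := recursive_code_head (recursive_code_behead rec_tl).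
apply: recursive_truth_case => //; try exact: recursive_digit.
exact: recursive_code_head.
Qed.

Lemma recursive_truth_table n (f g : n.-tuple nat -> nat) :
  recursive f -> recursive g -> recursive (fun x => truth_table (f x) (g x)).
Proof.
move=> rec_f rec_g.
apply: (@recursive_comp2 _ (fun a v => truth_table v a)) rec_g rec_f.
apply: (@recursive_nat_rect (fun=> 0)
  (fun y z v => z + truth_step v y z * base ^ y)); first exact: recursive_const.
apply: recursive_add; first exact: recursive_nth.
apply: recursive_mul.
  by apply: recursive_truth_step; exact: recursive_nth.
by apply: recursive_exp; [exact: recursive_const | exact: recursive_nth].
Qed.

Lemma recursive_sat_count n (f : n.-tuple nat -> nat) :
  recursive f -> recursive (fun x => sat_count (f x)).
Proof.
move=> rec_f; apply: recursive_bounded_sum => //; last first.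
  by apply: recursive_exp => //; exact: recursive_const.
apply: recursive_select => [|X]; last exact: recursive_const.
apply: recursive_truth_step; do ?exact: recursive_nth.
by apply: recursive_truth_table; exact: recursive_nth.
Qed.

End Extensions.

Theorem corollary2p5 (m : nat) (A : finType) (P : Type) (Omega : finType)
    (m_gt0 : 0 < m) (A_nonempty : 0 < #|A|) (P_nonempty : inhabited P)
    (card_Omega : #|Omega| = #|A|) :
  algorithmically_decidable (@satisfiable m A P Omega) /\
  algorithmically_decidable (@valid m A P Omega).
Proof.
have rec_sat n (f : n.-tuple nat -> nat) : recursive f ->
    recursive (fun x => 0 < sat_count m A P Omega (f x) : nat).
  move=> rec_f; apply: recursive_leq; first exact: recursive_const.
  exact: recursive_sat_count.
split.
  exists (fun x => 0 < sat_count m A P Omega (nth 0 x 0)).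
  split=> [|name phi /satisfiable_sat_count/= satE].
    exact/rec_sat/recursive_nth.
  by split=> [/satE -> //|unsat]; case: ltnP => // /satE/unsat.
(* The tag 2 turns the code of [phi] into that of [Neg phi]; the answer is 1 when no satisfying
   assignment of the negation is found. *)
exists (fun x =>
  1 - (0 < sat_count m A P Omega (CodeSeq.code [:: 2; nth 0 x 0]))).
split=> [|name phi /(@satisfiable_sat_count m A P Omega name (Neg phi))/= satE].
  apply: recursive_sub; first exact: recursive_const.
  apply: rec_sat; apply: recursive_code_cons; first exact: recursive_const.
  apply: recursive_code_cons; first exact: recursive_nth.
  exact: recursive_const.
split=> [valid_phi|nvalid_phi].
  case: ltnP => // /satE[M [a []]]; exact: valid_phi.
(* Classically, if [Neg phi] is unsatisfiable then [phi] holds at every agent of every model. *)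
suff /satE -> : satisfiable A (Neg phi) by [].
apply: contra_notP nvalid_phi => unsat M a.
by apply: contra_notP unsat => nsat; exists M, a.
Qed.
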